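(* Let $(V,E)$ be a finite directed graph, $w: E\to\mathbb R^+\setminus\{0\}$, $a: E\to\mathbb R$, $t>0$, $T_t = e^{-t\Delta_{w,a}/2}$, $S_t = (I-e^{-t\Delta_{w,a}})^{1/2}$, and $f\in\ell^2(V)$. Let $(f_k,g_k)_{k=0}^\infty$ be the sequence produced from $f$ by the scattering transform, i.e. $f_0=0$, $g_0=f$, and $f_{k+1}=T_t|g_k|$, $g_{k+1}=S_t|g_k|$ for all $k\ge 0$. Then for each $k\in\mathbb N$ with $k \ge 1$, $$\| g_k \| = \| S_t |g_{k-1} | \| \le \| S_t g_{k-1} \| .$$
   Context: A directed graph $(V,E)$ consists of a finite vertex set $V$ and a set $E$ of ordered pairs of vertices. $\ell^2(V)$ is the real Hilbert space of all functions $f: V\to\mathbb R$ with $\langle f,g\rangle = \sum_{j\in V} f(j)g(j)$ and norm $\|f\|=\langle f,f\rangle^{1/2}$. $\Delta_{w,a}$ is the (positive semidefinite) self-adjoint operator on $\ell^2(V)$ corresponding to the quadratic form $\langle \Delta_{w,a} f,f\rangle = \sum_{(i,j)\in E} w(i,j)\,|e^{a(i,j)}f(i)-f(j)|^2$. The square root is that of a positive semidefinite operator. For a function $g$, $|g|$ denotes the pointwise absolute value, $|g|(i)=|g(i)|$. *)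

(* Defs.v *)
From HB Require Import structures.
From mathcomp Require Import all_boot all_order all_algebra.
From mathcomp Require Import all_classical all_reals all_analysis.
From mathcomp Require Import ring.

Set Implicit Arguments.
Unset Strict Implicit.
Unset Printing Implicit Defensive.

Import Order.TTheory GRing.Theory Num.Theory.
Import numFieldNormedType.Exports.

Local Open Scope classical_set_scope.
Local Open Scope ring_scope.

(* [R^o] rather than [R] in the codomain: this is what makes [l2 R V] a
   [vectType], so that [op R V] is the type of its linear endomorphisms. *)
Notation l2 R V := {ffun V -> R^o}.
Notation op R V := 'End({ffun V -> R^o}).

Section Operators.
Context {R : realType} {V : finType}.
Implicit Types (f g : l2 R V) (A B : op R V).

Definition inner f g : R := \sum_(j : V) f j * g j.

Definition l2norm f : R := Num.sqrt (inner f f).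

Definition absf f : l2 R V := [ffun i => `|f i|].

Definition selfadjoint A : Prop := forall f g, inner (A f) g = inner f (A g).

Definition psd A : Prop := selfadjoint A /\ forall f, 0 <= inner (A f) f.

(* The exponential series, converging pointwise on [V] (equivalently in
   operator norm, the dimension being finite). [exp_opE] below shows that the
   series converges and that [linfun], which is only meaningful on linear maps,
   does not alter its sum. *)
Definition exp_op A : op R V :=
  linfun (fun f => [ffun i =>
    limn (series (fun k => iter k A f i / k`!%:R : R))] : l2 R V).

(* The operator 0 is returned when [A] has no positive semidefinite root, i.e.
   when [A] is not itself positive semidefinite. *)
Definition sqrt_op A : op R V :=
  xget 0 [set B : op R V | psd B /\ (B \o B)%VF = A].

Definition op_of_form (q : l2 R V -> R) : op R V :=
  xget 0 [set A : op R V | selfadjoint A /\ forall f, inner (A f) f = q f].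

End Operators.

Section Graph.
Context {R : realType} {V : finType}.
Variables (E : {set V * V}) (w a : V * V -> R).

Definition graph_form (f : l2 R V) : R :=
  \sum_(e in E) w e * `|expR (a e) * f e.1 - f e.2| ^+ 2.

Definition laplacian : op R V := op_of_form graph_form.

Definition T_op (t : R) : op R V := exp_op (- (t / 2) *: laplacian).

Definition S_op (t : R) : op R V := sqrt_op (\1%VF - exp_op (- t *: laplacian)).

End Graph.

Section WellDefined.
Context {R : realType} {V : finType}.
Implicit Types (f g h : l2 R V) (A B : op R V).

Lemma innerC f g : inner f g = inner g f.
Proof. by apply: eq_bigr => i _; rewrite mulrC. Qed.

Lemma innerDl f g h : inner (f + g) h = inner f h + inner g h.
Proof.
by rewrite /inner -big_split; apply: eq_bigr => i _; rewrite ffunE mulrDl.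
Qed.

Lemma innerDr f g h : inner h (f + g) = inner h f + inner h g.
Proof. by rewrite innerC innerDl !(innerC h). Qed.

Lemma inner_ge0 f : 0 <= inner f f.
Proof. by apply: sumr_ge0 => i _; rewrite -expr2 sqr_ge0. Qed.

Lemma inner_eq0 f : inner f f = 0 -> f = 0.
Proof.
move=> f0; apply/ffunP => i; rewrite ffunE.
have /psumr_eq0P : forall j : V, true -> 0 <= f j * f j :> R.
  by move=> j _; rewrite -expr2 sqr_ge0.
by move=> /(_ f0 i isT) /eqP; rewrite mulf_eq0 orbb => /eqP.
Qed.

Lemma op_of_form_unique A B : selfadjoint A -> selfadjoint B ->
  (forall f, inner (A f) f = inner (B f) f) -> A = B.
Proof.
move=> sA sB AB; apply/lfunP => f.
have pol g h : inner (A g) h = inner (B g) h.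
  have := AB (g + h); rewrite !linearD !innerDl !innerDr !AB.
  rewrite (sA h g) (sB h g) (innerC h (A g)) (innerC h (B g)).
  rewrite -!addrA => /addrI; rewrite !addrA => /addIr.
  rewrite -!mulr2n => /eqP; rewrite -subr_eq0 -mulrnBl mulrn_eq0 subr_eq0.
  by move=> /eqP.
have N g h : inner (- g) h = - inner g h.
  by rewrite /inner -sumrN; apply: eq_bigr => i _; rewrite ffunE mulNr.
apply/eqP; rewrite -subr_eq0; apply/eqP/inner_eq0.
by rewrite {1}innerDl N pol subrr.
Qed.

Section LaplacianSpec.
Variables (E : {set V * V}) (w a : V * V -> R).

Let grad e f : R := expR (a e) * f e.1 - f e.2.

Let lap_fun f : l2 R V := [ffun j => \sum_(e in E)
  w e * grad e f * (expR (a e) * (j == e.1)%:R - (j == e.2)%:R)].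

Let lap_fun_linear : linear lap_fun.
Proof.
move=> c f g; apply/ffunP => j; rewrite !ffunE.
rewrite scaler_sumr -big_split; apply: eq_bigr => e _ /=.
rewrite /grad !ffunE /GRing.scale /=; ring.
Qed.

HB.instance Definition _ := GRing.isLinear.Build R (l2 R V) (l2 R V) _
  lap_fun lap_fun_linear.

Let lap_inner f g :
  inner (lap_fun f) g = \sum_(e in E) w e * grad e f * grad e g.
Proof.
rewrite /inner (eq_bigr (fun j => \sum_(e in E) w e * grad e f *
  (expR (a e) * (j == e.1)%:R - (j == e.2)%:R) * g j)); last first.
  by move=> j _; rewrite ffunE mulr_suml.
rewrite exchange_big; apply: eq_bigr => e _ /=.
have d (x : V) : \sum_j (j == x)%:R * (g j : R) = g x.
  rewrite (bigD1 x) //= eqxx mul1r big1 ?addr0// => j /negbTE ->.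
  by rewrite mul0r.
rewrite /(grad e g) -(d e.1) -(d e.2) mulr_sumr -sumrB mulr_sumr.
by apply: eq_bigr => j _; rewrite -mulrA; congr (_ * _); rewrite mulrBl mulrA.
Qed.

Lemma laplacian_spec : selfadjoint (laplacian E w a) /\
  forall f, inner (laplacian E w a f) f = graph_form E w a f.
Proof.
apply: (@xgetPex _ 0 [set A : op R V |
  selfadjoint A /\ forall f, inner (A f) f = graph_form E w a f]).
exists (linfun lap_fun); split=> [f g|f]; rewrite !lfunE /=.
  rewrite lap_inner [RHS]innerC lap_inner.
  by apply: eq_bigr => e _; rewrite mulrAC.
rewrite lap_inner; apply: eq_bigr => e _.
by rewrite -mulrA -expr2 real_normK// num_real.
Qed.

End LaplacianSpec.

Section ExpSpec.
Variable A : op R V.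

Lemma iter_op_bound : exists2 C : R, 0 <= C &
  forall f k i, `|iter k A f i| <= C ^+ k * \sum_j `|f j|.
Proof.
pose d (j : V) : l2 R V := [ffun i => (i == j)%:R].
have dec f : f = \sum_j (f j : R) *: d j.
  apply/ffunP => i; rewrite sum_ffunE (bigD1 i) //= !ffunE eqxx big1.
    by rewrite /GRing.scale /= mulr1 addr0.
  by move=> j ij; rewrite !ffunE eq_sym (negbTE ij) /GRing.scale /= mulr0.
pose C := \sum_i \sum_j `|A (d j) i : R|; exists C.
  by apply: sumr_ge0 => i _; apply: sumr_ge0.
have step f : \sum_i `|A f i : R| <= C * \sum_j `|f j : R|.
  rewrite {1}(dec f) mulr_suml; apply: ler_sum => i _.
  rewrite linear_sum sum_ffunE; apply: (le_trans (ler_norm_sum _ _ _)).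
  rewrite mulr_suml; apply: ler_sum => j _.
  rewrite linearZ ffunE /GRing.scale /= normrM mulrC.
  by apply: ler_wpM2l => //; rewrite (bigD1 j) //= lerDl sumr_ge0.
move=> f k i.
apply: (@le_trans _ _ (\sum_j `|iter k A f j : R|)).
  by rewrite (bigD1 i) //= lerDl sumr_ge0.
elim: k => [|k IH]; first by rewrite expr0 mul1r.
apply: (le_trans (step _)); rewrite exprS -mulrA ler_wpM2l //.
by apply: sumr_ge0 => ? _; apply: sumr_ge0.
Qed.

Lemma is_cvg_exp_op f i :
  cvgn (series (fun k => iter k A f i / k`!%:R : R)).
Proof.
have [C C0 bC] := iter_op_bound.
apply: normed_cvg.
apply: (@series_le_cvg _ _ ((\sum_j `|f j : R|) *: exp_coeff C)).
- by move=> n /=.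
- move=> n; rewrite mulr_ge0 ?sumr_ge0 //.
  by rewrite /exp_coeff /= divr_ge0 // exprn_ge0.
- move=> n /=; rewrite normrM normfV normr_nat.
  rewrite [leRHS](_ : _ = C ^+ n * (\sum_j `|f j : R|) / n`!%:R).
    by rewrite ler_wpM2r.
  rewrite fctE /exp_coeff /GRing.scale /=. ring.
- by apply: is_cvg_seriesZ; exact: is_cvg_series_exp_coeff.
Qed.

Lemma exp_opE f i :
  exp_op A f i = limn (series (fun k => iter k A f i / k`!%:R : R)).
Proof.
pose F g : l2 R V := [ffun j =>
  limn (series (fun k => iter k A g j / k`!%:R : R))].
have FL : linear F.
  move=> c g h; apply/ffunP => j; rewrite !ffunE.
  apply: cvg_lim => //.
  have -> : (fun k => iter k A (c *: g + h) j / k`!%:R : R) =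
      c *: (fun k => iter k A g j / k`!%:R : R) +
      (fun k => iter k A h j / k`!%:R : R).
    apply/funext => k.
    have -> : iter k A (c *: g + h) = c *: iter k A g + iter k A h.
      by elim: k => //= k ->; rewrite linearP.
    by rewrite !ffunE !fctE /GRing.scale /=; ring.
  rewrite seriesD seriesZ; apply: cvgD; last exact: is_cvg_exp_op.
  by apply: cvgZr; exact: is_cvg_exp_op.
pose FLm := GRing.isLinear.Build R (l2 R V) (l2 R V) _ F FL.
pose G : {linear l2 R V -> l2 R V} := HB.pack F FLm.
by rewrite [exp_op A](_ : _ = linfun G) // lfunE /= ffunE.
Qed.

End ExpSpec.

End WellDefined.

(* Main.v *)
(** [S_t] is either [0] or a self-adjoint root of [I - e^{-tΔ}], and in the latter
    case [‖S_t g‖² = ‖g‖² - ⟨e^{-tΔ} g, g⟩]; so it suffices that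
    [⟨e^{-tΔ} g, g⟩ ≤ ⟨e^{-tΔ} |g|, |g|⟩], which holds as soon as [e^{-tΔ}]
    preserves nonnegative functions.  The off-diagonal entries of [-tΔ] are
    nonnegative, so [-tΔ = N - c] with [N] entrywise nonnegative, and the
    exponential series of [N - c] is the Cauchy product of the series of [N],
    with nonnegative terms, and that of [e^{-c} > 0]. *)
Require Import Defs.
From mathcomp Require Import all_boot all_order all_algebra.
From mathcomp Require Import all_classical all_reals all_analysis.
From mathcomp Require Import ring lra.

Import Order.TTheory GRing.Theory Num.Theory.
Import numFieldNormedType.Exports.
Local Open Scope classical_set_scope.
Local Open Scope ring_scope.

(** Summing over the triangle of index pairs with [p] outermost; the identity is exact for finite
    sums, so no convergence is involved. *)
Lemma series_convolution (R : realType) (u v : nat -> R) (n : nat) :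
  series (fun k => \sum_(p < k.+1) u p * v (k - p)%N) n =
  \sum_(p < n) u p * series v (n - p)%N.
Proof.
elim: n => [|n IH]; first by rewrite /series /= big_geq // big_ord0.
rewrite /series /= big_nat_recr //= -[X in X + _]/(series _ n) IH.
have -> : \sum_(p < n) u p * series v (n - p)%N =
    \sum_(p < n.+1) u p * series v (n - p)%N.
  by rewrite big_ord_recr /= subnn /series /= [X in _ * X]big_geq // mulr0 addr0.
rewrite -big_split; apply: eq_bigr => p _ /=.
rewrite subSn; last by rewrite -ltnS.
by rewrite /series /= [in RHS]big_nat_recr //= mulrDr.
Qed.

(* All but finitely many partial sums of [v] are nonnegative, so a partial sum
   of the Cauchy product is at least minus a constant times a short block of
   the tail of [u]. *)
Lemma lim_series_convolution_ge0 (R : realType) (u v : nat -> R) :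
  (forall p, 0 <= u p) -> cvgn (series u) ->
  cvgn (series v) -> 0 < limn (series v) ->
  cvgn (series (fun k => \sum_(p < k.+1) u p * v (k - p)%N)) ->
  0 <= limn (series (fun k => \sum_(p < k.+1) u p * v (k - p)%N)).
Proof.
move=> u0 cu cv v0 cw.
set w := series _ in cw *.
have [m _ mv] : \forall n \near \oo, 0 < series v n.
  exact: (cvgr_gt (limn (series v)) cv).
have [K K0 Kv] : exists2 K : R, 0 <= K & forall n, - K <= series v n.
  have [K [_ KP]] := cvg_seq_bounded cv.
  exists (Num.max 0 (K + 1)); first by rewrite le_max lexx.
  move=> n; rewrite lerNl; apply: (@le_trans _ _ (K + 1)).
    by apply: (le_trans (ler_norm _)); rewrite normrN; apply: KP; rewrite ?ltrDl.
  by rewrite le_max lexx orbT.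
(* Split the sum at [p = n]: below it the index [n + m - p] is at least [m], so the partial sum of
   [v] is positive; in the last [m] terms it is only bounded below by [- K]. *)
have wE n : - (K * (series u (n + m)%N - series u n)) <= w (n + m)%N.
  rewrite /w series_convolution -(big_mkord xpredT
    (fun p => u p * series v (n + m - p)%N)) (big_cat_nat (leq0n n)) ?leq_addr //=.
  rewrite sub_series_geq ?leq_addr // -mulNr mulr_sumr.
  rewrite -[leLHS]add0r lerD //.
    rewrite big_nat_cond; apply: sumr_ge0 => p /andP[/andP[_ pn] _].
    rewrite mulr_ge0 // ltW //; apply: mv => /=.
    by rewrite addnC -addnBA ?leq_addr // ltnW.
  by apply: ler_sum => p _; rewrite mulrC ler_wpM2l.
have cw' : (fun n => w (n + m)%N) @ \oo --> limn w.
  by rewrite (cvg_shiftn m w).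
(* The lower bound tends to [0], since a shift by [m] does not change the limit of [series u]. *)
have cu' : (fun n => - (K * (series u (n + m)%N - series u n))) @ \oo -->
    - (K * (limn (series u) - limn (series u))).
  apply: cvgN; apply: cvgMr; apply: cvgB => //.
  by rewrite (cvg_shiftn m (series u)).
rewrite subrr mulr0 oppr0 in cu'.
by apply: (ler_cvg_to cu' cw'); near=> n; exact: wE.
Unshelve. all: by end_near.
Qed.

Section Positivity.
Context {R : realType} {V : finType}.
Implicit Types (f g h : l2 R V) (A B N : op R V).

Definition nonneg f : Prop := forall i, 0 <= f i :> R.

Definition positivity_preserving A : Prop := forall f, nonneg f -> nonneg (A f).

Let delta (j : V) : l2 R V := [ffun i => (i == j)%:R].

Lemma innerNl f h : inner (- f) h = - inner f h.
Proof. by rewrite /inner -sumrN; apply: eq_bigr => i _; rewrite ffunE mulNr. Qed.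

Lemma innerZl (c : R) f h : inner (c *: f) h = c * inner f h.
Proof.
by rewrite /inner mulr_sumr; apply: eq_bigr => i _; rewrite ffunE mulrA.
Qed.

Lemma inner_delta f (i : V) : inner f (delta i) = f i.
Proof.
rewrite /inner (bigD1 i) //= ffunE eqxx mulr1 big1 ?addr0 // => j /negbTE ji.
by rewrite ffunE ji mulr0.
Qed.

Lemma l2_delta_sum f : f = \sum_j (f j : R) *: delta j.
Proof.
apply/ffunP => i; rewrite sum_ffunE (bigD1 i) //= !ffunE eqxx big1.
  by rewrite /GRing.scale /= mulr1 addr0.
by move=> j ij; rewrite !ffunE eq_sym (negbTE ij) /GRing.scale /= mulr0.
Qed.

Lemma op_coordE A f i : A f i = \sum_j f j * (A (delta j) i : R) :> R.
Proof.
rewrite {1}(l2_delta_sum f) linear_sum sum_ffunE.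
by apply: eq_bigr => j _; rewrite linearZ ffunE.
Qed.

Lemma inner_absf f : inner (absf f) (absf f) = inner f f.
Proof.
by apply: eq_bigr => i _; rewrite !ffunE -!expr2 real_normK ?num_real.
Qed.

(** Applying [A] to the nonnegative functions [absf g - g] and [absf g + g] gives [|A g| <= A |g|]
    pointwise; multiply by [|g|] and sum. *)
Lemma positivity_preserving_absf A g : positivity_preserving A ->
  inner (A g) g <= inner (A (absf g)) (absf g).
Proof.
move=> A0; apply: ler_sum => i _; apply: (le_trans (ler_norm _)).
rewrite normrM [absf g i]ffunE ler_wpM2r // ler_norml.
have gm : nonneg (absf g - g).
  by move=> j; rewrite !ffunE subr_ge0 ler_norm.
have gp : nonneg (absf g + g).
  by move=> j; rewrite !ffunE -lerBlDr sub0r -normrN ler_norm.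
have := A0 _ gm i; have := A0 _ gp i.
by rewrite linearB linearD !ffunE subr_ge0 lerNl -(subr_ge0 (- _)) opprK addrC => -> ->.
Qed.

(** The binomial theorem, available because [N] commutes with scalars; the induction step is
    Pascal's rule. *)
Lemma iter_subZ N (c : R) f k :
  iter k (N - c *: \1%VF : op R V) f =
  \sum_(p < k.+1) ('C(k, p)%:R * (- c) ^+ (k - p)) *: iter p N f.
Proof.
elim: k => [|k IH]; first by rewrite big_ord1 bin0 expr0 mulr1 scale1r.
rewrite iterS IH add_lfunE opp_lfunE scale_lfunE id_lfunE linear_sum.
rewrite [in RHS]big_ord_recl /= bin0.
under [in RHS]eq_bigr => p _ do rewrite /bump /= add1n binS natrD mulrDl scalerDl.
rewrite big_split /= addrA addrC; congr (_ + _).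
  by apply: eq_bigr => p _; rewrite linearZ subSS.
(* The top coefficient ['C(k, k.+1)] vanishes; what remains matches the summands produced by
   [- c]. *)
rewrite [in RHS]big_ord_recr /= bin_small // mul0r scale0r addr0.
rewrite big_ord_recl /= bin0 scalerDr opprD -scaleNr scalerA; congr (_ + _).
  by rewrite !mul1r !subn0 exprS.
rewrite -scaleNr scaler_sumr; apply: eq_bigr => p _.
rewrite /bump /= add1n scalerA subSS; congr (_ *: _).
by rewrite -[(k - p)%N]prednK ?subn_gt0 // -subnS exprS mulrCA.
Qed.

Lemma exp_op_subZ_positivity N (c : R) : positivity_preserving N ->
  positivity_preserving (exp_op (N - c *: \1%VF)).
Proof.
move=> N0 f f0 i; rewrite exp_opE.
have Nk0 k : nonneg (iter k N f) by elim: k => //= k; exact: N0.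
have := @is_cvg_exp_op R V (N - c *: \1%VF : op R V) f i.
(* Dividing the binomial expansion by [k!] turns ['C(k, p)] into [1 / (p! (k - p)!)]. *)
have -> : (fun k => iter k (N - c *: \1%VF : op R V) f i / k`!%:R : R) =
    (fun k => \sum_(p < k.+1)
      (iter p N f i / p`!%:R) * exp_coeff (- c) (k - p)%N).
  apply/funext => k; rewrite iter_subZ sum_ffunE mulr_suml.
  apply: eq_bigr => p _; rewrite ffunE /exp_coeff /GRing.scale /=.
  have pk : (p <= k)%N by rewrite -ltnS.
  rewrite -(bin_fact pk) !natrM.
  have C0 : 'C(k, p)%:R != 0 :> R by rewrite pnatr_eq0 -lt0n bin_gt0.
  have p0 : p`!%:R != 0 :> R by rewrite pnatr_eq0 -lt0n fact_gt0.
  have q0 : (k - p)`!%:R != 0 :> R by rewrite pnatr_eq0 -lt0n fact_gt0.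
  by field; rewrite C0 p0 q0.
apply: (@lim_series_convolution_ge0 R (fun p => iter p N f i / p`!%:R)
  (exp_coeff (- c))) => [p|||].
- by apply: divr_ge0; [exact: Nk0|exact: ler0n].
- exact: is_cvg_exp_op.
- exact: is_cvg_series_exp_coeff.
- exact: expR_gt0.
Qed.

Lemma exp_op_positivity A :
  (forall i j, i != j -> 0 <= inner (A (delta j)) (delta i)) ->
  positivity_preserving (exp_op A).
Proof.
(* This [c] dominates the absolute value of every diagonal entry, so [A + c] has only nonnegative
   entries. *)
move=> A0; pose c : R := \sum_i `|A (delta i) i : R|.
rewrite (_ : A = (A + c *: \1%VF) - c *: \1%VF); last by rewrite addrK.
apply: exp_op_subZ_positivity => f f0 i.
rewrite add_lfunE scale_lfunE id_lfunE !ffunE op_coordE (bigD1 i) //=.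
rewrite addrAC addr_ge0 //; last first.
  apply: sumr_ge0 => j ji; rewrite mulr_ge0 // -inner_delta A0 //.
  by rewrite eq_sym.
rewrite /GRing.scale /= mulrC -mulrDl mulr_ge0 //.
rewrite -lerBlDl sub0r (le_trans (ler_norm _)) // normrN /c (bigD1 i) //=.
by rewrite lerDl sumr_ge0.
Qed.

(** Polarization expresses the entry through [graph_form], edge by edge. Since [i != j], only an
    edge [e] joining [i] and [j] contributes, with cross term [- 2 * w e * expR (a e)]. *)
Lemma laplacian_offdiag_le0 (E : {set V * V}) (w a : V * V -> R) (i j : V) :
  (forall e, e \in E -> 0 < w e) -> i != j ->
  inner (laplacian E w a (delta j)) (delta i) <= 0.
Proof.
move=> w_gt0 ij; have [sL qL] := laplacian_spec E w a.
set L := laplacian _ _ _ in sL qL *.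
have q2 : inner (L (delta j)) (delta i) *+ 2 =
    graph_form E w a (delta j + delta i) - graph_form E w a (delta j)
    - graph_form E w a (delta i).
  rewrite -!qL linearD innerDl !innerDr (sL (delta i) (delta j)).
  rewrite (innerC (delta i)); ring.
rewrite -(@pmulrn_lle0 _ _ 2) // q2 /graph_form -!sumrB.
apply: sumr_le0 => e eE; rewrite -!mulrBr; apply: mulr_ge0_le0.
  exact: ltW (w_gt0 _ eE).
rewrite !real_normK ?num_real // !ffunE.
have ea := expR_gt0 (a e); set r := expR (a e) in ea *.
have [e1i|e1i] := eqVneq e.1 i; have [e2i|e2i] := eqVneq e.2 i;
  rewrite ?e1i ?e2i ?(negbTE ij);
  case: (e.1 == j); case: (e.2 == j); rewrite ?mulr0n ?mulr1n; nra.
Qed.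

Lemma heat_positivity (E : {set V * V}) (w a : V * V -> R) (t : R) :
  (forall e, e \in E -> 0 < w e) -> 0 < t ->
  positivity_preserving (exp_op (- t *: laplacian E w a)).
Proof.
move=> w_gt0 t0; apply: exp_op_positivity => i j ij.
rewrite scale_lfunE innerZl mulNr oppr_ge0 pmulr_rle0 //.
exact: laplacian_offdiag_le0.
Qed.

Lemma l2norm_sqrt_op_absf A g : positivity_preserving A ->
  l2norm (sqrt_op (\1%VF - A) (absf g)) <= l2norm (sqrt_op (\1%VF - A) g).
Proof.
(* Both sides share the same chosen root [B]; if there is none, both are the norm of [0]. *)
move=> A0; rewrite /sqrt_op; case: xgetP => [B _ [[sB _] BB]|_]; last first.
  by rewrite !zero_lfunE.
have normB h : inner (B h) (B h) = inner h h - inner (A h) h.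
  rewrite -sB -comp_lfunE BB add_lfunE opp_lfunE id_lfunE.
  by rewrite innerDl innerNl.
rewrite /l2norm ler_sqrt ?inner_ge0 // !normB inner_absf lerB //.
exact: positivity_preserving_absf.
Qed.

End Positivity.

Theorem proposition3p2 (R : realType) (V : finType) (E : {set V * V})
    (w a : V * V -> R) (w_gt0 : forall e, e \in E -> 0 < w e)
    (t : R) (t_gt0 : 0 < t) (f : l2 R V) (fs gs : nat -> l2 R V)
    (fs0 : fs 0%N = 0) (gs0 : gs 0%N = f)
    (fsS : forall k, fs k.+1 = T_op E w a t (absf (gs k)))
    (gsS : forall k, gs k.+1 = S_op E w a t (absf (gs k)))
    (k : nat) (k_ge1 : (1 <= k)%N) :
  l2norm (gs k) = l2norm (S_op E w a t (absf (gs k.-1))) /\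
  l2norm (S_op E w a t (absf (gs k.-1))) <= l2norm (S_op E w a t (gs k.-1)).
Proof.
split; first by rewrite -gsS prednK.
(* [S_op] unfolds to [sqrt_op] of the identity minus the heat operator. *)
exact/l2norm_sqrt_op_absf/heat_positivity.
Qed.
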